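(* Let $k\ge 1$ be an integer, let $X\in\mathcal{C}_k$ and let $f:\mathcal{C}_k\to\mathcal{C}_k$ be a map such that: (1) $\lim_{n\to+\infty}|V(f^n(X))|=+\infty$; (2) there exists $m\in\mathbb{N}$ such that for all $n\ge m$, $1\le p_n\le 2k\,|V(f^n(X))|-1$, where $p_n$ is the number of particles in $f^n(X)$. Then $\lim_{n\to+\infty}S'(f^n(X))=+\infty$.
   Context: $\mathcal{C}_k$ is the set of circular graphs with $2k$ information bits per vertex: an element $X$ is a finite nonempty cycle graph with vertex set $V(X)$ (vertices carry names), where each vertex has two ports $a$ and $b$, each edge joins a port $b$ to a port $a$, every port is used exactly once, and each vertex $u$ carries bits $a_1(u),\dots,a_k(u)$ (attached to port $a$) and $b_1(u),\dots,b_k(u)$ (attached to port $b$) in $\{0,1\}$. A bit equal to $1$ is a particle; the number of particles of $X$ is the total number of bits equal to $1$. The entropy function $S'$ is the logarithm of the number of ways of placing the particles given the size of the graph and its number of particles (ignoring vertex names): for $X\in\mathcal{C}_k$ with $p$ particles, $S'(X)=\log\binom{2k|V(X)|}{p}$. *)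

(* Defs.v *)
From HB Require Import structures.
From mathcomp Require Import all_boot all_order all_algebra finmap.
From mathcomp Require Import all_classical all_reals all_analysis.
Set Implicit Arguments.
Unset Strict Implicit.
Unset Printing Implicit Defensive.
Import Order.TTheory GRing.Theory Num.Theory.
Local Open Scope ring_scope.

(* [(u, v) \in edges] means that port b of u is joined to port a of v, so an
   edge is identified by its two ports: the 1-cycle is a self-loop (u, u), and
   the 2-cycle has the two distinct edges (u, v) and (v, u).
   The axioms are boolean, so a graph is determined by its data fields. *)
Record circular_graph (name : choiceType) (k : nat) := CircularGraph {
  vertices : {fset name};
  edges : {set vertices * vertices};
  bits_a : {ffun vertices -> {ffun 'I_k -> bool}};
  bits_b : {ffun vertices -> {ffun 'I_k -> bool}};
  vertices_neq0 : vertices != fset0;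
  port_b_once : [forall u, #|[set v | (u, v) \in edges]| == 1%N];
  port_a_once : [forall v, #|[set u | (u, v) \in edges]| == 1%N];
  edges_connected : [forall u, forall v,
    connect [rel x y | ((x, y) \in edges) || ((y, x) \in edges)] u v]
}.

Definition order_of (name : choiceType) (k : nat)
    (X : circular_graph name k) : nat :=
  #|` vertices X|.

Definition particles (name : choiceType) (k : nat)
    (X : circular_graph name k) : nat :=
  (\sum_(u : vertices X) \sum_(i < k) (bits_a X u i + bits_b X u i))%N.

Definition entropy (R : realType) (name : choiceType) (k : nat)
    (X : circular_graph name k) : R :=
  ln ('C(2 * k * order_of X, particles X))%:R.

(* Main.v *)
Require Import Defs.
From HB Require Import structures.
From mathcomp Require Import all_boot all_order all_algebra finmap.
From mathcomp Require Import all_classical all_reals all_analysis.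
Set Implicit Arguments.
Unset Strict Implicit.
Unset Printing Implicit Defensive.
Import Order.TTheory GRing.Theory Num.Theory.
Local Open Scope classical_set_scope.
Local Open Scope ring_scope.

(** Away from the two ends, every entry of row [n] of Pascal's triangle is at least [n]. Since
    eventually the particles neither vanish nor fill all [2 * k * N] places, the binomial
    coefficient is at least [2 * k * N >= N], so its logarithm diverges with the size [N]. *)

Lemma leq_bin_interior (n m : nat) : (0 < m < n)%N -> (n <= 'C(n, m))%N.
Proof.
elim: n m => [|n IHn] [|m] // /andP[_]; rewrite ltnS => lt_mn.
have [->|m_neq0] := eqVneq m 0%N; first by rewrite bin1.
(* Pascal's rule. At the right edge the induction hypothesis fails for ['C(n, m.+1) = 1], but the
   other term is [n]; elsewhere the terms are at least [n] and [1]. *)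
rewrite binS; move: lt_mn; rewrite leq_eqVlt => /orP[/eqP eq_mn|lt_mn].
  by rewrite -eq_mn binn binSn.
apply: (@leq_trans (n + 1)); first by rewrite addn1.
by rewrite leq_add ?IHn // bin_gt0 ltnW // ltnW.
Qed.

Theorem theorem2 (R : realType) (name : choiceType) (k : nat) (hk : (1 <= k)%N)
    (X : circular_graph name k)
    (f : circular_graph name k -> circular_graph name k)
    (hsize : order_of (iter n f X) @[n --> \oo] --> \oo)
    (hpart : exists m : nat, forall n : nat, (m <= n)%N ->
       (1 <= particles (iter n f X)
          <= 2 * k * order_of (iter n f X) - 1)%N) :
  entropy R (iter n f X) @[n --> \oo] --> +oo.
Proof.
have [m part_bounds] := hpart.
apply/cvgryPge => A.
(* [A <= ln x] amounts to [expR A <= x] for [x > 0], so a size beyond [expR A] suffices. *)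
move/cvgnyPge/(_ (Num.bound (expR A))): hsize => size_large.
near=> n.
have le_size : (Num.bound (expR A) <= order_of (iter n f X))%N by near: n.
have /part_bounds/andP[part_gt0 part_le] : (m <= n)%N by near: n; exists m.
set N := order_of _ in le_size part_le; set p := particles _ in part_gt0 part_le.
(* Subtraction is truncated: [2 * k * N = 0] would force [p <= 0]. Positivity makes the upper bound
   the strict [p < 2 * k * N]. *)
have N_gt0 : (0 < 2 * k * N)%N.
  by case: (2 * k * N)%N part_le => // /(leq_trans part_gt0).
have le_N_bin : (N <= 'C(2 * k * N, p))%N.
  apply: (@leq_trans (2 * k * N)); first by rewrite leq_pmull // muln_gt0.
  by apply: leq_bin_interior; rewrite part_gt0 -(subnK N_gt0) addn1 ltnS.
have expA_le : expR A <= 'C(2 * k * N, p)%:R.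
  apply: le_trans (ltW (archi_boundP (expR_ge0 A))) _.
  by rewrite ler_nat (leq_trans le_size).
rewrite /entropy -[A]expRK ler_ln ?posrE ?expR_gt0 //.
exact: lt_le_trans (expR_gt0 A) expA_le.
Unshelve. all: by end_near.
Qed.
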